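(* Let $R$ be a Lie conformal algebra. Then: (1) $[CDer(R)_\lambda C(R)]_\mu\subseteq C(R)[\lambda]$. (2) $[QDer(R)_\lambda QC(R)]_\mu\subseteq QC(R)[\lambda]$. (3) $[QC(R)_\lambda QC(R)]_\mu\subseteq QDer(R)[\lambda]$.
   Context: Let $\mathcal{A}=\mathbb{C}[\partial]$. A Lie conformal algebra is an $\mathcal{A}$-module $R$ with a $\mathbb{C}$-bilinear map $R\otimes R\to R[\lambda]$, $a\otimes b\mapsto[a_\lambda b]$, such that for all $a,b,c\in R$: $[\partial a_\lambda b]=-\lambda[a_\lambda b]$, $[a_\lambda\partial b]=(\partial+\lambda)[a_\lambda b]$; $[a_\lambda b]=-[b_{-\lambda-\partial}a]$; $[a_\lambda[b_\mu c]]=[[a_\lambda b]_{\lambda+\mu}c]+[b_\mu[a_\lambda c]]$. $gc(R)=Cend(R)$ is the set of conformal linear maps from $R$ to $R$, i.e. $\mathbb{C}$-linear maps $D_\lambda:R\to R[\lambda]$ with $D_\lambda(\partial a)=(\partial+\lambda)D_\lambda(a)$ for all $a\in R$ (the indeterminate may be renamed). It is an $\mathcal{A}$-module via $(\partial D)_\lambda(a)=-\lambda D_\lambda(a)$, with $\lambda$-bracket $[D_1{}_\lambda D_2]_\mu a=D_{1\,\lambda}(D_{2\,\mu-\lambda}a)-D_{2\,\mu-\lambda}(D_{1\,\lambda}a)$ (the general Lie conformal algebra). For subsets $X,Y,Z\subseteq gc(R)$, $[X_\lambda Y]_\mu\subseteq Z[\lambda]$ means: for all $D_1\in X$, $D_2\in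 Y$, all coefficients of the powers of $\lambda$ in $[D_1{}_\lambda D_2]_\mu$ (these are elements of $gc(R)$, with indeterminate $\mu$) belong to $Z$. Brackets such as $[(D_\lambda a)_{\lambda+\mu}b]$ are extended linearly over polynomials in the indeterminates. $CDer(R)$ (conformal derivations): $D_\lambda\in gc(R)$ with $D_\lambda([a_\mu b])=[(D_\lambda a)_{\lambda+\mu}b]+[a_\mu(D_\lambda b)]$ for all $a,b\in R$. $QDer(R)$ (conformal quasiderivations): $D_\lambda\in gc(R)$ for which there is $D'_\lambda\in gc(R)$ with $[(D_\lambda a)_{\lambda+\mu}b]+[a_\mu(D_\lambda b)]=D'_\lambda([a_\mu b])$ for all $a,b\in R$. $C(R)$ (conformal centroids): $D_\lambda\in gc(R)$ with $D_\lambda([a_\mu b])=[(D_\lambda a)_{\lambda+\mu}b]=[a_\mu(D_\lambda b)]$ for all $a,b\in R$. $QC(R)$ (conformal quasicentroids): $D_\lambda\in gc(R)$ with $[(D_\lambda a)_{\lambda+\mu}b]=[a_\mu(D_\lambda b)]$ for all $a,b\in R$. *)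

(* Defs.v *)
From HB Require Import structures.
From mathcomp Require Import all_boot all_algebra.
From mathcomp Require Import finmap.
From mathcomp Require Import monalg.
From mathcomp Require Import complex.
From mathcomp Require Import reals.

Set Implicit Arguments.
Unset Strict Implicit.
Unset Printing Implicit Defensive.

Import GRing.Theory.
Local Open Scope ring_scope.

(* M[x] for an S-module M: finitely supported coefficient families nat -> M.
   It is an S[x]-module for the convolution action, so R[lambda] is again a
   module over a polynomial ring, and R[mu][lambda] is obtained by iterating. *)
Definition polym (S : nzRingType) (M : lmodType S) : Type := {malg M[nat]}.

HB.instance Definition _ (S : nzRingType) (M : lmodType S) :=
  GRing.Zmodule.on (polym M).

Section PolymScale.
Context (S : nzRingType) (M : lmodType S).
Implicit Types (p q : {poly S}) (u v : polym M).

Definition polym_scale p u : polym M :=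
  \sum_(i < size p) \sum_(k <- msupp u) << p`_i *: u@_k *g (i + k)%N >>.

Lemma polym_eqP u v : (forall n, u@_n = v@_n) -> u = v.
Proof. by move=> uv; apply/malgP. Qed.

Lemma coef_polym_scale p u n :
  (polym_scale p u)@_n = \sum_(i < n.+1) p`_i *: u@_(n - i)%N.
Proof.
have inner i : (\sum_(k <- msupp u) << p`_i *: u@_k *g (i + k)%N >>)@_n =
    (if (i <= n)%N then p`_i *: u@_(n - i)%N else 0).
  rewrite raddf_sum /=.
  under eq_bigr => k _ do rewrite mcoeffU.
  case: leqP => [le_in|lt_ni]; last first.
    by apply: big1 => k _; case: eqP lt_ni => // <-; rewrite ltnNge leq_addr.
  have [uni|] := boolP ((n - i)%N \in msupp u).
    rewrite (bigD1_seq (n - i)%N) ?fset_uniq //= subnKC // eqxx mulr1n.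
    rewrite big1 ?addr0 // => k nk; case: eqP => // eqn; move: nk.
    by rewrite -eqn addKn eqxx.
  move=> uni; rewrite (mcoeff_outdom uni) scaler0 big1_seq // => k /andP[_ ku].
  by case: eqP => // eqn; move: uni; rewrite -eqn addKn ku.
rewrite /polym_scale raddf_sum /=.
under eq_bigr => i _ do rewrite inner.
rewrite -(big_mkord xpredT
           (fun i => (if (i <= n)%N then p`_i *: u@_(n - i)%N else 0))).
rewrite -(big_mkord xpredT (fun i => p`_i *: u@_(n - i)%N)).
pose N := maxn (size p) n.+1.
rewrite (big_nat_widen _ _ N) ?leq_maxl // [RHS](big_nat_widen _ _ N) ?leq_maxr //.
rewrite big_mkcond [RHS]big_mkcond /=; apply: eq_bigr => i _.
rewrite ltnS; case: ltnP => // szp; case: leqP => // _.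
by rewrite nth_default // scale0r.
Qed.

Lemma polym_scaleA p q u :
  polym_scale p (polym_scale q u) = polym_scale (p * q) u.
Proof.
apply: polym_eqP => n; rewrite !coef_polym_scale.
under eq_bigr => i _ do rewrite coef_polym_scale scaler_sumr.
under [RHS]eq_bigr => m _ do rewrite coefM scaler_suml.
transitivity (\sum_(i < n.+1) \sum_(m < n.+1 | (i <= m)%N)
    p`_i *: (q`_(m - i)%N *: u@_(n - m)%N)).
  apply: eq_bigr => i _.
  rewrite -(big_mkord (fun m => (i <= m)%N)
     (fun m => p`_i *: (q`_(m - i)%N *: u@_(n - m)%N))).
  rewrite -(big_mkord xpredT (fun j => p`_i *: (q`_j *: u@_(n - i - j)%N))).
  have ile : (i <= n.+1)%N by rewrite ltnW.
  rewrite [RHS](big_cat_nat _ ile) //= [X in _ = X + _]big_nat_cond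
    [X in _ = X + _]big1 ?add0r; last first.
    move=> j /andP[/andP[_ ji] ij]; by move: (leq_trans ji ij); rewrite ltnn.
  rewrite -[X in index_iota X n.+1]add0n big_addn subSn; last exact: (ltn_ord i).
  rewrite [RHS]big_mkcond /=; apply: eq_bigr => j _.
  by rewrite leq_addl addnK addnC subnDA.
rewrite (exchange_big_dep xpredT) //=; apply: eq_bigr => m _.
rewrite -(big_mkord (fun i => (i <= m)%N)
   (fun i => p`_i *: (q`_(m - i)%N *: u@_(n - m)%N))).
rewrite -(big_mkord xpredT (fun i => (p`_i * q`_(m - i)%N) *: u@_(n - m)%N)).
rewrite [RHS](big_nat_widen _ _ n.+1) ?ltn_ord //=.
by apply: eq_bigr => i _; rewrite scalerA.
Qed.

Lemma polym_scale1 u : polym_scale 1 u = u.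
Proof.
apply: polym_eqP => n; rewrite coef_polym_scale big_ord_recl big1 /=.
  by rewrite coef1 scale1r subn0 addr0.
by move=> i _; rewrite coef1 scale0r.
Qed.

Lemma polym_scaleDr p : {morph polym_scale p : u v / u + v}.
Proof.
move=> u v; apply: polym_eqP => n; rewrite mcoeffD !coef_polym_scale.
by rewrite -big_split; apply: eq_bigr => i _; rewrite mcoeffD scalerDr.
Qed.

Lemma polym_scaleDl u : {morph polym_scale^~ u : p q / p + q}.
Proof.
move=> p q; apply: polym_eqP => n; rewrite mcoeffD !coef_polym_scale.
by rewrite -big_split; apply: eq_bigr => i _; rewrite coefD scalerDl.
Qed.

HB.instance Definition _ := GRing.Zmodule_isLmodule.Build {poly S} (polym M)
  polym_scaleA polym_scale1 polym_scaleDr polym_scaleDl.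

Definition polymC (a : M) : polym M := << a *g 0%N >>.

(* For u = \sum_k a_k x^k, [extend f q u] is \sum_k q^k f(a_k): the map f is
   extended linearly over polynomials and q is substituted for x. *)
Definition extend (T : nzRingType) (N : lmodType T) (f : M -> N) (q : T) u : N :=
  \sum_(k <- msupp u) q ^+ k *: f u@_k.

End PolymScale.

Section Conformal.
Context (F : fieldType).

Local Notation A := {poly F}.

(* The variables of A[mu][lambda]; lambda is the outermost variable, so the
   coefficient of lambda^k of an element of R[mu][lambda] lies in R[mu]. *)
Definition lam : {poly {poly A}} := 'X.
Definition mu : {poly {poly A}} := 'X%:P.

Context (R : lmodType A).

Local Notation "R[x]" := (polym R).
Local Notation "R[x,y]" := (polym (polym R : lmodType {poly A})).

Definition at_var (q : {poly {poly A}}) (u : R[x]) : R[x,y] :=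
  extend (fun a : R => polymC (polymC a)) q u.

Definition Clinear_to_polym (D : R -> R[x]) : Prop :=
  forall (c : F) (a b : R), D (c%:P *: a + b) = c%:P%:P *: D a + D b.

(* In A[x], 'X%:P is the derivation d (the variable of A) and 'X is lambda. *)
Record lie_conformal (br : R -> R -> R[x]) : Prop := LieConformal {
  lie_linearl : forall b, Clinear_to_polym (br^~ b);
  lie_linearr : forall a, Clinear_to_polym (br a);
  lie_sesquil : forall a b, br ('X *: a) b = - ('X *: br a b);
  lie_sesquir : forall a b, br a ('X *: b) = ('X%:P + 'X) *: br a b;
  lie_skew : forall a b,
    br a b = - extend (@polymC A R) (- 'X - 'X%:P) (br b a);
  lie_jacobi : forall a b c,
    extend (fun x => at_var lam (br a x)) mu (br b c) =
    extend (fun x => at_var (lam + mu) (br x c)) lam (br a b)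
    + extend (fun x => at_var mu (br b x)) lam (br a c)
}.

Definition gc (D : R -> R[x]) : Prop :=
  Clinear_to_polym D /\ forall a, D ('X *: a) = ('X%:P + 'X) *: D a.

(* [D1_lambda D2]_mu a, in R[mu][lambda] *)
Definition gc_bracket (D1 D2 : R -> R[x]) (a : R) : R[x,y] :=
  extend (fun x => at_var lam (D1 x)) (mu - lam) (D2 a)
  - extend (fun x => at_var (mu - lam) (D2 x)) lam (D1 a).

(* [X_lambda Y]_mu is included in Z[lambda] *)
Definition gc_bracket_sub (X Y Z : (R -> R[x]) -> Prop) : Prop :=
  forall D1 D2, X D1 -> Y D2 -> forall k, Z (fun a => (gc_bracket D1 D2 a)@_k).

Context (br : R -> R -> R[x]).

(* D_lambda [a_mu b] *)
Definition on_bracket (D : R -> R[x]) (a b : R) : R[x,y] :=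
  extend (fun x => at_var lam (D x)) mu (br a b).

(* [(D_lambda a)_{lambda+mu} b] *)
Definition on_left (D : R -> R[x]) (a b : R) : R[x,y] :=
  extend (fun x => at_var (lam + mu) (br x b)) lam (D a).

(* [a_mu (D_lambda b)] *)
Definition on_right (D : R -> R[x]) (a b : R) : R[x,y] :=
  extend (fun x => at_var mu (br a x)) lam (D b).

Definition CDer (D : R -> R[x]) : Prop :=
  gc D /\ forall a b, on_bracket D a b = on_left D a b + on_right D a b.

Definition QDer (D : R -> R[x]) : Prop :=
  gc D /\ exists D', gc D' /\
    forall a b, on_left D a b + on_right D a b = on_bracket D' a b.

Definition Centroid (D : R -> R[x]) : Prop :=
  gc D /\ forall a b,
    on_bracket D a b = on_left D a b /\ on_left D a b = on_right D a b.

Definition QCentroid (D : R -> R[x]) : Prop :=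
  gc D /\ forall a b, on_left D a b = on_right D a b.

End Conformal.

(* Main.v *)
From HB Require Import structures.
Require Import Defs.
From mathcomp Require Import all_boot all_algebra.
From mathcomp Require Import finmap monalg.
From mathcomp Require Import complex.
From mathcomp Require Import reals.

Set Implicit Arguments.
Unset Strict Implicit.
Unset Printing Implicit Defensive.

Import GRing.Theory Num.Theory.
Local Open Scope ring_scope.

(** The field of scalars is infinite, so a polynomial with coefficients in a
    vector space is determined by its values at scalars.  Write [D_c] for the
    linear endomorphism of [R] obtained from a conformal linear map [D] by
    setting its indeterminate to the scalar [c], and [[a_m b]] for the value
    of the lambda-bracket at [m].  Then every identity to be proved becomes an
    identity between linear endomorphisms of [R]; for instance a
    quasicentroid is characterised by [[(D_l a)_{l+m} b] = [a_m (D_l b)]], and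
    the bracket of [D] and [E], at lambda = [c] and mu = [s], is the commutator
    of [D_c] and [E_e] with [e = s - c].

    For [D], [E] quasicentroids, applying the defining property twice moves
    both maps to the right argument and reverses their order:
    [[(D_c E_e a)_{s+m} b] = [a_m (E_e D_c b)]].  Hence the left and right
    actions of the commutator are opposite to each other, and it is a
    quasiderivation with companion map 0 ([QCentroid_QCentroid_sub]).

    For [D] a quasiderivation with companion [D'] and [E] a quasicentroid,
    [[(D_c E_e a)_{s+m} b] = D'_c [a_m (E_e b)] - [a_m (E_e D_c b)]] and
    [[(E_e D_c a)_{s+m} b] = D'_c [a_m (E_e b)] - [a_m (D_c E_e b)]]; the terms
    in [D'] cancel in the difference ([QDer_QCentroid_sub]).  The case of
    derivations and centroids adds one more such cancellation
    ([CDer_Centroid_sub]).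

    The inclusions are about each coefficient, in lambda, of the bracket.  Each
    condition is linear in the map, so it holds for all the coefficients as
    soon as it holds for all the values at lambda = [c], by interpolation
    ([value_coef_eq]). *)

(** * Evaluation of polynomials with coefficients in a module *)

(* Locked, since comparing two evaluations by computation is intractable. *)
HB.lock Definition eval (S : comNzRingType) (M : lmodType S) (q : S)
  (u : polym M) : M := extend id q u.

Section Evaluation.
Context (S : comNzRingType) (M : lmodType S).
Implicit Types (q : S) (u v : polym M).

Lemma evalE q u : eval q u = \sum_(k <- msupp u) q ^+ k *: u@_k.
Proof. by rewrite eval.unlock. Qed.

(** Replaces the support by any larger finite set, so that several evaluations
    can be compared as sums over one index set. *)
Lemma eval_widen q u (d : {fset nat}) : (msupp u `<=` d)%fset ->
  eval q u = \sum_(k <- d) q ^+ k *: u@_k.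
Proof.
move=> ud; rewrite evalE; apply: big_fset_incl ud _ => k _ ku.
by rewrite mcoeff_outdom // scaler0.
Qed.

Lemma evalD q : {morph @eval S M q : u v / u + v}.
Proof.
move=> u v; rewrite (eval_widen q (msuppD_le u v)).
rewrite (eval_widen q (fsubsetUl (msupp u) (msupp v))).
rewrite (eval_widen q (fsubsetUr (msupp u) (msupp v))).
by rewrite -big_split /=; apply: eq_bigr => k _; rewrite mcoeffD scalerDr.
Qed.

Lemma eval0 q : eval q (0 : polym M) = 0.
Proof. by apply: (addIr (eval q (0 : polym M))); rewrite -evalD !add0r. Qed.

Lemma evalN q : {morph @eval S M q : u / - u}.
Proof.
by move=> u; apply: (addIr (eval q u)); rewrite -evalD !addNr eval0.
Qed.

Lemma eval_sum q I (s : seq I) (f : I -> polym M) :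
  eval q (\sum_(i <- s) f i) = \sum_(i <- s) eval q (f i).
Proof. exact: (big_morph _ (evalD q) (eval0 q)). Qed.

Lemma evalU q (x : M) k : eval q (<< x *g k >> : polym M) = q ^+ k *: x.
Proof.
by rewrite (eval_widen q msuppU_le) big_seq_fset1 mcoeffU eqxx mulr1n.
Qed.

(** The action on [polym M] is convolution, hence evaluation is multiplicative. *)
Lemma evalZ q (p : {poly S}) u : eval q (p *: u) = p.[q] *: eval q u.
Proof.
rewrite [p *: u]/(polym_scale p u) /polym_scale eval_sum horner_coef.
rewrite scaler_suml; apply: eq_bigr => i _; rewrite eval_sum evalE scaler_sumr.
by apply: eq_bigr => k _; rewrite evalU !scalerA exprD mulrC mulrA.
Qed.

End Evaluation.

(** Evaluating after substituting [r] amounts to substituting the value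
    of [r]. *)
Lemma eval_extend (S T : comNzRingType) (M : lmodType S) (N : lmodType T)
    (f : M -> polym N) (r : {poly T}) (q : T) (u : polym M) :
  eval q (extend (f : M -> (polym N : lmodType {poly T})) r u)
  = extend (fun x => eval q (f x)) r.[q] u.
Proof.
rewrite /extend eval_sum; apply: eq_bigr => k _.
by rewrite evalZ horner_exp.
Qed.

(** * Separation by values at scalars *)

Section Interpolation.
Context (F : numFieldType).

(** Extraction of the coefficient of degree [j] as a combination of the values
    at 0, ..., n-1: the Vandermonde matrix of these points is invertible in
    characteristic 0. *)
Lemma coef_interpolation n (j : nat) : (j < n)%N ->
  exists w : 'I_n -> F, forall k, (k < n)%N ->
    \sum_t w t * t%:R ^+ k = (k == j)%:R.
Proof.
move=> jn; pose a : 'rV[F]_n := \row_t t%:R.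
have Vu : Vandermonde n a \in unitmx.
  rewrite unitmxE det_Vandermonde unitfE; apply/prodf_neq0 => i _.
  apply/prodf_neq0 => i' ii'; rewrite !mxE subr_eq0 eqr_nat.
  by rewrite neq_ltn ii' orbT.
exists (fun t => invmx (Vandermonde n a) t (Ordinal jn)) => k kn.
have /(congr1 (fun B : 'M_n => B (Ordinal kn) (Ordinal jn))) := mulmxV Vu.
rewrite !mxE /= -val_eqE /= => <-.
by apply: eq_bigr => t _; rewrite !mxE mulrC.
Qed.

(** Scalars come from [F] through [phi], so that the same lemma serves
    coefficients in a [{poly F}]-module and in a [{poly {poly F}}]-module. *)
Lemma eval_inj (S : comNzRingType) (M : lmodType S) (phi : {rmorphism F -> S})
    (u v : polym M) :
  (forall c, eval (phi c) u = eval (phi c) v) -> u = v.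
Proof.
move=> uv; apply/eqP; rewrite -subr_eq0; apply/eqP.
have {uv} : forall c, eval (phi c) (u - v) = 0.
  by move=> c; rewrite evalD evalN uv subrr.
move: (u - v) => {u v} u u0; apply: polym_eqP => j; rewrite mcoeff0.
have [ju|/mcoeff_outdom//] := boolP (j \in msupp u).
pose n := (\max_(k <- msupp u) k).+1.
have ltn k : k \in msupp u -> (k < n)%N.
  by move=> ku; rewrite ltnS; apply: (leq_bigmax_seq (F := id)).
have [w wP] := coef_interpolation (ltn j ju).
have <- : \sum_t phi (w t) *: eval (phi t%:R) u = u@_j.
  under eq_bigr => t _ do rewrite evalE scaler_sumr.
  rewrite exchange_big /= (bigD1_seq j) ?fset_uniq //=.
  rewrite [X in _ + X]big_seq_cond [X in _ + X]big1 ?addr0 => [|k /andP[ku kj]].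
    under eq_bigr => t _ do rewrite scalerA -rmorphXn -rmorphM.
    by rewrite -scaler_suml -rmorph_sum wP ?ltn // eqxx rmorph1 scale1r.
  under eq_bigr => t _ do rewrite scalerA -rmorphXn -rmorphM.
  by rewrite -scaler_suml -rmorph_sum wP ?ltn // (negPf kj) rmorph0 scale0r.
by rewrite big1 // => t _; rewrite u0 scaler0.
Qed.

End Interpolation.

(** * Maps that are linear over the ground field *)

Section ScalarLinear.
Context (F : fieldType).

(** Linearity over [F] of maps between modules over two different [F]-algebras,
    as with [value c : polym R -> R]. *)
Definition scalar_linear (S T : nzRingType) (phi : F -> S) (psi : F -> T)
    (M : lmodType S) (N : lmodType T) (f : M -> N) : Prop :=
  forall c a b, f (phi c *: a + b) = psi c *: f a + f b.

Context (S T : comNzRingType).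
Context (phi : {rmorphism F -> S}) (psi : {rmorphism F -> T}).
Context (M : lmodType S) (N : lmodType T) (f : M -> N).
Context (fL : scalar_linear phi psi f).

Lemma scalar_linearD : {morph f : a b / a + b}.
Proof. by move=> a b; rewrite -[a]scale1r -(rmorph1 phi) fL !rmorph1 !scale1r. Qed.

Lemma scalar_linear0 : f 0 = 0.
Proof. by apply: (addIr (f 0)); rewrite -scalar_linearD !add0r. Qed.

Lemma scalar_linearB : {morph f : a b / a - b}.
Proof.
by move=> a b; apply: (addIr (f b)); rewrite -scalar_linearD !subrK.
Qed.

Lemma scalar_linearZ c a : f (phi c *: a) = psi c *: f a.
Proof. by rewrite -[phi c *: a]addr0 fL scalar_linear0 addr0. Qed.

(** Linear maps commute with evaluation at scalars: applying [f] to the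
    coefficients and substituting [c] gives [f] of the value at [c]. *)
Lemma extend_scalar_linear c u : extend f (psi c) u = f (eval (phi c) u).
Proof.
rewrite evalE /extend (big_morph _ scalar_linearD scalar_linear0).
by apply: eq_bigr => k _; rewrite -!rmorphXn scalar_linearZ.
Qed.

Definition coef_map (u : polym M) : polym N :=
  \sum_(k <- msupp u) << f u@_k *g k >>.

Lemma coef_coef_map u k : (coef_map u)@_k = f u@_k.
Proof.
rewrite /coef_map raddf_sum /=.
have [ku|ku] := boolP (k \in msupp u).
  rewrite (bigD1_seq k) ?fset_uniq //= mcoeffU eqxx mulr1n big1 ?addr0 //.
  by move=> i ik; rewrite mcoeffU (negPf ik).
rewrite (mcoeff_outdom ku) scalar_linear0 big_seq big1 // => i iu.
by rewrite mcoeffU; case: eqP => // ik; rewrite -ik iu in ku.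
Qed.

Lemma eval_coef_map c u : eval (psi c) (coef_map u) = f (eval (phi c) u).
Proof.
rewrite -extend_scalar_linear /coef_map eval_sum.
by apply: eq_bigr => k _; rewrite evalU.
Qed.

End ScalarLinear.

(** * Values of conformal maps and of the lambda-bracket *)

Lemma coef_polymCZ (S : nzRingType) (M : lmodType S) (p : S) (u : polym M) k :
  (p%:P *: u)@_k = p *: u@_k.
Proof.
rewrite [p%:P *: u]/(polym_scale p%:P u) coef_polym_scale big_ord_recl big1 /=.
  by rewrite coefC eqxx subn0 addr0.
by move=> i _; rewrite coefC scale0r.
Qed.

Section Values.
Context (F : numFieldType) (R : lmodType {poly F}).

Local Notation A := {poly F}.
Local Notation C1 := (polyC : {rmorphism F -> A}).
Local Notation C2 := ((polyC \o polyC) : {rmorphism F -> {poly A}}).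

Implicit Types (c d l m s : F) (a b x : R) (u : polym R).
Implicit Types (w : polym (polym R : lmodType {poly A})).
Implicit Types (D E : R -> polym R).

Definition value c u : R := eval c%:P u.

(** The outer variable lambda takes the value [l], the inner variable mu the
    value [m]. *)
Definition value2 l m w : R := value m (eval l%:P%:P w).

Lemma value_linear s : scalar_linear C2 C1 (value s).
Proof. by move=> c u v; rewrite /value evalD evalZ hornerC. Qed.

Lemma value_inj u v : (forall c, value c u = value c v) -> u = v.
Proof. exact: (@eval_inj F _ _ C1). Qed.

Lemma value2_inj w w' :
  (forall l m, value2 l m w = value2 l m w') -> w = w'.
Proof.
move=> ww'; apply: (@eval_inj F _ _ C2) => l.
by apply: value_inj => m; exact: ww'.
Qed.

Lemma value2B l m : {morph value2 l m : w w' / w - w'}.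
Proof. by move=> w w'; rewrite /value2 /value !evalD !evalN. Qed.

Lemma value2D l m : {morph value2 l m : w w' / w + w'}.
Proof. by move=> w w'; rewrite /value2 /value !evalD. Qed.

Lemma value2Z l m p w :
  value2 l m (p *: w) = p.[l%:P%:P].[m%:P] *: value2 l m w.
Proof. by rewrite /value2 /value !evalZ. Qed.

Lemma eq_value2_linear c w w1 w2 :
    (forall l m, value2 l m w = c%:P *: value2 l m w1 + value2 l m w2) ->
  w = c%:P%:P%:P *: w1 + w2.
Proof.
by move=> ww; apply: value2_inj => l m; rewrite ww value2D value2Z !hornerC.
Qed.

Lemma eq_value2_muZ (p : A) w w1 :
    (forall l m, value2 l m w = (p + m%:P) *: value2 l m w1) ->
  w = (p%:P + 'X)%:P *: w1.
Proof.
move=> ww; apply: value2_inj => l m.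
by rewrite ww value2Z hornerC hornerD hornerC hornerX.
Qed.

Lemma value2_extend l m (r : {poly {poly A}})
    (f : R -> polym (polym R : lmodType {poly A})) u :
  value2 l m (extend f r u)
  = extend (fun x => value2 l m (f x)) r.[l%:P%:P].[m%:P] u.
Proof.
rewrite /value2 (eval_extend f) /value.
by rewrite (eval_extend (fun x => eval l%:P%:P (f x))).
Qed.

Lemma value2C l m x : value2 l m (polymC (polymC x)) = x.
Proof.
rewrite /value2 (evalU _ (polymC x) 0) expr0 scale1r.
by rewrite /value (evalU _ x 0) expr0 scale1r.
Qed.

Lemma value2_at_var l m d (q : {poly {poly A}}) u : q.[l%:P%:P].[m%:P] = d%:P ->
  value2 l m (at_var q u) = value d u.
Proof.
move=> qd; rewrite /at_var value2_extend qd [RHS]evalE; apply: eq_bigr => k _.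
by rewrite value2C.
Qed.

(** The two-variable expressions in play ([gc_bracket], [on_bracket],
    [on_left], [on_right]) are built from terms of this shape: a map [f], with
    its variable renamed [q], is applied to the coefficients of [u], and [r] is
    substituted for the variable of [u].  At scalars this is the composition
    of [f] with an evaluation. *)
Lemma value2_extend_at_var l m c d (r q : {poly {poly A}}) (f : R -> polym R) u :
    Clinear_to_polym f ->
    r.[l%:P%:P].[m%:P] = c%:P -> q.[l%:P%:P].[m%:P] = d%:P ->
  value2 l m (extend (fun x => at_var q (f x)) r u) = value d (f (value c u)).
Proof.
move=> fL rc qd; rewrite value2_extend rc.
have gL : scalar_linear C1 C1 (fun x => value d (f x)).
  by move=> e a b; rewrite fL value_linear.
rewrite -(extend_scalar_linear gL); apply: eq_bigr => k _.
by rewrite (value2_at_var _ qd).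
Qed.

Lemma lam_value l m : (lam F).[l%:P%:P].[m%:P] = l%:P.
Proof. by rewrite /lam hornerX hornerC. Qed.

Lemma mu_value l m : (mu F).[l%:P%:P].[m%:P] = m%:P.
Proof. by rewrite /mu hornerC hornerX. Qed.

Lemma lamDmu_value l m : (lam F + mu F).[l%:P%:P].[m%:P] = (l + m)%:P.
Proof. by rewrite !hornerD lam_value mu_value polyCD. Qed.

Lemma muBlam_value l m : (mu F - lam F).[l%:P%:P].[m%:P] = (m - l)%:P.
Proof. by rewrite !hornerD !hornerN lam_value mu_value polyCB. Qed.

Definition act D c x : R := value c (D x).

Lemma act_linear D c : gc D -> scalar_linear C1 C1 (act D c).
Proof. by move=> [DL _] e a b; rewrite /act DL value_linear. Qed.

Lemma act_X D c x : gc D -> act D c ('X *: x) = ('X + c%:P) *: act D c x.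
Proof.
by move=> [_ DX]; rewrite /act DX /value evalZ hornerD hornerC hornerX.
Qed.

(** Membership of a coefficient in [gc], tested on values: the relations defining
    [gc] involve mu but not lambda, hence pass to coefficients in lambda. *)
Lemma gc_coef (E : R -> polym (polym R : lmodType {poly A})) k :
    (forall l m, scalar_linear C1 C1 (fun a => value2 l m (E a))) ->
    (forall l m a, value2 l m (E ('X *: a)) = ('X + m%:P) *: value2 l m (E a)) ->
  gc (fun a => (E a)@_k).
Proof.
move=> EL EX; split=> [c a b|a].
  rewrite (eq_value2_linear (fun l m => EL l m c a b)).
  by rewrite mcoeffD coef_polymCZ.
by rewrite (eq_value2_muZ (fun l m => EX l m a)) coef_polymCZ.
Qed.

Definition commutator D1 D2 l m a : R :=
  act D1 l (act D2 (m - l) a) - act D2 (m - l) (act D1 l a).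

Lemma value2_gc_bracket D1 D2 l m a : gc D1 -> gc D2 ->
  value2 l m (gc_bracket D1 D2 a) = commutator D1 D2 l m a.
Proof.
move=> [D1L _] [D2L _]; rewrite /gc_bracket value2B.
rewrite (value2_extend_at_var _ D1L (muBlam_value l m) (lam_value l m)).
by rewrite (value2_extend_at_var _ D2L (lam_value l m) (muBlam_value l m)).
Qed.

Lemma gc_gc_bracket D1 D2 k : gc D1 -> gc D2 ->
  gc (fun a => (gc_bracket D1 D2 a)@_k).
Proof.
move=> D1gc D2gc.
have vE l m a := value2_gc_bracket l m a D1gc D2gc.
(* From here on only the values of the bracket matter. *)
move: (gc_bracket D1 D2) vE => E vE.
apply: gc_coef => [l m c a b|l m a]; rewrite !vE /commutator.
  rewrite !(act_linear _ D1gc) !(act_linear _ D2gc) !(act_linear _ D1gc).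
  by rewrite scalerBr opprD addrACA.
(* The shift by [m - l] in one map and by [l] in the other add up to [m]. *)
have XDE f c x p : gc f -> act f c (('X + p%:P) *: x)
    = ('X + (c + p)%:P) *: act f c x.
  move=> fgc; rewrite scalerDl (scalar_linearD (act_linear c fgc)) act_X //.
  by rewrite (scalar_linearZ (act_linear c fgc)) -scalerDl -addrA polyCD.
rewrite !act_X // !XDE // [l + _]addrC subrK.
by rewrite -scalerBr.
Qed.

(** Passage from values to coefficients in lambda, under linear conditions:
    both sides are the coefficients of the polynomials obtained by applying
    [g] and [h] coefficientwise, and these polynomials have the same values. *)
Lemma value_coef_eq (g h : R -> R) s w w' k :
    scalar_linear C1 C1 g -> scalar_linear C1 C1 h ->
    (forall c, g (value2 c s w) = h (value2 c s w')) ->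
  g (value s w@_k) = h (value s w'@_k).
Proof.
move=> gL hL gh.
have gvL : scalar_linear C2 C1 (g \o value s).
  by move=> c u v; rewrite /= value_linear gL.
have hvL : scalar_linear C2 C1 (h \o value s).
  by move=> c u v; rewrite /= value_linear hL.
suff: coef_map (g \o value s) w = coef_map (h \o value s) w'.
  by move/(congr1 (mcoeff k)); rewrite (coef_coef_map gvL) (coef_coef_map hvL).
apply: value_inj => c.
rewrite /value (eval_coef_map gvL) (eval_coef_map hvL); exact: gh.
Qed.

Lemma coef_gc_bracket_eq D1 D2 (g h : R -> R) s a b k :
    gc D1 -> gc D2 -> scalar_linear C1 C1 g -> scalar_linear C1 C1 h ->
    (forall c, g (commutator D1 D2 c s a) = h (commutator D1 D2 c s b)) ->
  g (act (fun x => (gc_bracket D1 D2 x)@_k) s a)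
  = h (act (fun x => (gc_bracket D1 D2 x)@_k) s b).
Proof.
move=> D1gc D2gc gL hL gh.
have vE l m x := value2_gc_bracket l m x D1gc D2gc.
move: (gc_bracket D1 D2) vE => E vE.
by apply: value_coef_eq => // c; rewrite !vE.
Qed.

Section Bracket.
Context (br : R -> R -> polym R).
Context (brL : forall b, Clinear_to_polym (br^~ b)).
Context (brR : forall a, Clinear_to_polym (br a)).

Definition bracket_at c a b : R := value c (br a b).

Lemma bracket_at_linearl c b : scalar_linear C1 C1 ((bracket_at c)^~ b).
Proof. by move=> e x y; rewrite /bracket_at brL value_linear. Qed.

Lemma bracket_at_linearr c a : scalar_linear C1 C1 (bracket_at c a).
Proof. by move=> e x y; rewrite /bracket_at brR value_linear. Qed.

Lemma value2_on_bracket D l m a b : gc D ->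
  value2 l m (on_bracket br D a b) = act D l (bracket_at m a b).
Proof.
move=> [DL _].
by rewrite (value2_extend_at_var _ DL (mu_value l m) (lam_value l m)).
Qed.

Lemma value2_on_left D l m a b :
  value2 l m (on_left br D a b) = bracket_at (l + m) (act D l a) b.
Proof.
by rewrite (value2_extend_at_var _ (brL b) (lam_value l m) (lamDmu_value l m)).
Qed.

Lemma value2_on_right D l m a b :
  value2 l m (on_right br D a b) = bracket_at m a (act D l b).
Proof.
by rewrite (value2_extend_at_var _ (brR a) (lam_value l m) (mu_value l m)).
Qed.

Lemma QCentroid_at D l m a b : QCentroid br D ->
  bracket_at (l + m) (act D l a) b = bracket_at m a (act D l b).
Proof.
by move=> [_ DQ]; rewrite -value2_on_left DQ value2_on_right.
Qed.

Lemma QCentroid_of_values D : gc D ->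
    (forall l m a b,
       bracket_at (l + m) (act D l a) b = bracket_at m a (act D l b)) ->
  QCentroid br D.
Proof.
move=> Dgc DQ; split=> [|a b]; first exact: Dgc.
apply: value2_inj => l m; apply: etrans (value2_on_left D l m a b) _.
exact: etrans (DQ l m a b) (esym (value2_on_right D l m a b)).
Qed.

Lemma Centroid_QCentroid D : Centroid br D -> QCentroid br D.
Proof. by move=> [Dgc DC]; split=> [|a b]; [exact: Dgc | exact: (DC a b).2]. Qed.

Lemma Centroid_at D l m a b : Centroid br D ->
  act D l (bracket_at m a b) = bracket_at (l + m) (act D l a) b.
Proof.
move=> [Dgc DC]; have [e _] := DC a b.
by rewrite -value2_on_bracket // e value2_on_left.
Qed.

Lemma Centroid_of_values D : QCentroid br D ->
    (forall l m a b,
       act D l (bracket_at m a b) = bracket_at (l + m) (act D l a) b) ->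
  Centroid br D.
Proof.
move=> [Dgc DQ] DC; split=> [|a b]; first exact: Dgc.
split; last exact: DQ.
apply: value2_inj => l m; apply: etrans (value2_on_bracket l m a b Dgc) _.
exact: etrans (DC l m a b) (esym (value2_on_left D l m a b)).
Qed.

Lemma CDer_QDer D : CDer br D -> QDer br D.
Proof.
move=> [Dgc DD]; split; first exact: Dgc.
by exists D; split; [exact: Dgc | move=> a b; rewrite DD].
Qed.

Lemma QDer_at D : QDer br D -> exists2 D', gc D' & forall l m a b,
  bracket_at (l + m) (act D l a) b + bracket_at m a (act D l b)
  = act D' l (bracket_at m a b).
Proof.
move=> [_ [D' [D'gc DD']]]; exists D' => // l m a b.
by rewrite -value2_on_left -value2_on_right -value2D DD' value2_on_bracket.
Qed.

(** The companion map is 0. *)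
Lemma QDer_of_opposite_values D : gc D ->
    (forall l m a b,
       bracket_at (l + m) (act D l a) b = - bracket_at m a (act D l b)) ->
  QDer br D.
Proof.
move=> Dgc DN; split; first exact: Dgc.
have gc0 : gc (fun _ : R => 0 : polym R).
  by split=> [c a b|a]; rewrite scaler0 ?addr0.
exists (fun=> 0); split=> [|a b]; first exact: gc0.
apply: value2_inj => l m; rewrite value2D.
apply: etrans (esym (value2_on_bracket l m a b gc0)).
rewrite [RHS]/act [RHS]/value eval0; apply/eqP; rewrite addr_eq0; apply/eqP.
apply: etrans (value2_on_left D l m a b) _; apply: etrans (DN l m a b) _.
by congr (- _); apply: esym; exact: value2_on_right.
Qed.

Lemma CDer_at D l m a b : CDer br D ->
  act D l (bracket_at m a b)
  = bracket_at (l + m) (act D l a) b + bracket_at m a (act D l b).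
Proof.
move=> [Dgc DD].
by rewrite -value2_on_left -value2_on_right -value2D -DD value2_on_bracket.
Qed.

(** * Brackets of derivations and centroids *)

(** Each composite of the two maps, acting on the left argument, is expressed
    through the companion [D'] of the quasiderivation; the two terms in [D']
    agree. *)
Lemma QDer_QCentroid_sub :
  gc_bracket_sub (QDer br) (QCentroid br) (QCentroid br).
Proof.
move=> D1 D2 D1Q D2Q k; have [D' D'gc D'P] := QDer_at D1Q.
have [[D1gc _] [D2gc _]] := (D1Q, D2Q).
apply: QCentroid_of_values => [|s m a b]; first exact: gc_gc_bracket.
apply: (@coef_gc_bracket_eq D1 D2 ((bracket_at (s + m))^~ b) (bracket_at m a)
  s a b k D1gc D2gc (bracket_at_linearl _ b) (bracket_at_linearr m a)) => c.
rewrite /commutator; set e := s - c.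
rewrite (scalar_linearB (bracket_at_linearl _ b)).
rewrite (scalar_linearB (bracket_at_linearr m a)).
have sE : s = c + e by rewrite addrC subrK.
have -> : bracket_at (s + m) (act D1 c (act D2 e a)) b
    = act D' c (bracket_at m a (act D2 e b))
      - bracket_at m a (act D2 e (act D1 c b)).
  apply/eqP; rewrite sE -addrA eq_sym subr_eq -!(QCentroid_at e m a) //.
  by rewrite D'P.
have -> : bracket_at (s + m) (act D2 e (act D1 c a)) b
    = act D' c (bracket_at m a (act D2 e b))
      - bracket_at m a (act D1 c (act D2 e b)).
  apply/eqP; rewrite eq_sym subr_eq sE [c + e]addrC -addrA QCentroid_at //.
  by rewrite D'P.
by rewrite opprB addrC addrA subrK.
Qed.

(** By [QDer_QCentroid_sub] it remains to pull the commutator out of the bracket.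
    Expanding both orders of composition by Leibniz, the terms where the
    derivation hits [b] are [[(E_e a)_{e+m} (D_c b)]] in both cases and
    cancel. *)
Lemma CDer_Centroid_sub :
  gc_bracket_sub (CDer br) (Centroid br) (Centroid br).
Proof.
move=> D1 D2 D1D D2C k; have D2Q := Centroid_QCentroid D2C.
have EQ := QDer_QCentroid_sub (CDer_QDer D1D) D2Q k.
have [[D1gc _] [D2gc _]] := (D1D, D2C).
apply: Centroid_of_values => [|s m a b]; first exact: EQ.
have idL : scalar_linear C1 C1 (@id R) by [].
apply: (@coef_gc_bracket_eq D1 D2 id ((bracket_at (s + m))^~ b)
  s (bracket_at m a b) a k D1gc D2gc idL (bracket_at_linearl _ b)) => c.
rewrite /commutator; set e := s - c.
rewrite (scalar_linearB (bracket_at_linearl _ b)).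
have sE1 : c + (e + m) = s + m by rewrite addrA [c + e]addrC subrK.
have sE2 : e + (c + m) = s + m by rewrite addrA subrK.
rewrite Centroid_at // !CDer_at // (scalar_linearD (act_linear e D2gc)).
by rewrite !Centroid_at // sE1 sE2 opprD addrACA subrr addr0.
Qed.

(** A product of two quasicentroids changes sides in reversed order, so the
    commutator changes sides with a sign. *)
Lemma QCentroid_QCentroid_sub :
  gc_bracket_sub (QCentroid br) (QCentroid br) (QDer br).
Proof.
move=> D1 D2 D1Q D2Q k; have [[D1gc _] [D2gc _]] := (D1Q, D2Q).
apply: QDer_of_opposite_values => [|s m a b]; first exact: gc_gc_bracket.
have NL : scalar_linear C1 C1 (fun x => - bracket_at m a x).
  by move=> c x y; rewrite bracket_at_linearr opprD scalerN.
apply: (@coef_gc_bracket_eq D1 D2 ((bracket_at (s + m))^~ b)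
  (fun x => - bracket_at m a x)
  s a b k D1gc D2gc (bracket_at_linearl _ b) NL) => c.
rewrite /commutator; set e := s - c.
rewrite (scalar_linearB (bracket_at_linearl _ b)).
rewrite (scalar_linearB (bracket_at_linearr m a)) opprB.
have sE : s = c + e by rewrite addrC subrK.
congr (_ - _).
  by rewrite sE -addrA !QCentroid_at.
by rewrite sE [c + e]addrC -addrA !QCentroid_at.
Qed.

End Bracket.
End Values.

Theorem lemma3p8 (K : realType) (R : lmodType {poly complex K})
    (br : R -> R -> polym R) (hR : lie_conformal br) :
  [/\ gc_bracket_sub (CDer br) (Centroid br) (Centroid br),
      gc_bracket_sub (QDer br) (QCentroid br) (QCentroid br)
    & gc_bracket_sub (QCentroid br) (QCentroid br) (QDer br)].
Proof.
have [brL brR _ _ _ _] := hR; split.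
- exact: (@CDer_Centroid_sub (complex K)).
- exact: (@QDer_QCentroid_sub (complex K)).
- exact: (@QCentroid_QCentroid_sub (complex K)).
Qed.
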